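(* Let $r \in \mathbb{N}$ and let $K \subset \mathbb{Z}^r$. If $K$ is ubiquitous, then $K$ is strictly positive definite.
   Context: $\mathbb{Z}^r$ is regarded as the dual group of $\mathbb{T}^r$ via $\gamma(z) = \prod_{k=1}^r z_k^{\gamma_k}$. A trigonometric polynomial on $\mathbb{Z}^r$ is a function of the form $\gamma \mapsto \sum_{i=1}^n c_i \gamma(x_i)$ with $x_i \in \mathbb{T}^r$, $c_i \in \mathbb{C}$. A subset $K \subset \mathbb{Z}^r$ is strictly positive definite if the only trigonometric polynomial vanishing at every point of $K$ is the identically zero function. $K$ is ubiquitous if for every subgroup $H$ of $\mathbb{Z}^r$ of finite index and every $\gamma \in \mathbb{Z}^r$ the coset $\gamma + H$ meets $K$. *)

(* Defs.v *)
From HB Require Import structures.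
From mathcomp Require Import all_boot all_order all_algebra.
Set Implicit Arguments. Unset Strict Implicit. Unset Printing Implicit Defensive.
Import Order.TTheory GRing.Theory Num.Theory.
Local Open Scope ring_scope.

(* Z^r is represented as integer row vectors 'rV[int]_r; C is a numeric
   algebraically closed field (the complex numbers are an instance). *)

Definition torus_pt (C : numClosedFieldType) (r : nat) (z : 'I_r -> C) : Prop :=
  forall k, `|z k| = 1.

Definition char_eval (C : numClosedFieldType) (r : nat)
  (g : 'rV[int]_r) (z : 'I_r -> C) : C :=
  \prod_(k < r) (z k) ^ (g ord0 k).

Definition is_trig_poly (C : numClosedFieldType) (r : nat)
  (f : 'rV[int]_r -> C) : Prop :=
  exists (n : nat) (c : 'I_n -> C) (x : 'I_n -> 'I_r -> C),
    (forall i, torus_pt (x i)) /\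
    (forall g, f g = \sum_(i < n) c i * char_eval g (x i)).

Definition strictly_pos_def (C : numClosedFieldType) (r : nat)
  (K : 'rV[int]_r -> Prop) : Prop :=
  forall f : 'rV[int]_r -> C, is_trig_poly f ->
    (forall g, K g -> f g = 0) -> forall g, f g = 0.

Definition is_subgroup (r : nat) (H : 'rV[int]_r -> Prop) : Prop :=
  H 0 /\ (forall a b, H a -> H b -> H (a - b)).

Definition finite_index (r : nat) (H : 'rV[int]_r -> Prop) : Prop :=
  exists s : seq 'rV[int]_r, forall g, exists2 t, t \in s & H (g - t).

Definition ubiquitous (r : nat) (K : 'rV[int]_r -> Prop) : Prop :=
  forall H, is_subgroup H -> finite_index H ->
    forall g, exists k, K k /\ H (k - g).

(* Main.v *)
Require Import Defs.
From HB Require Import structures.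
From mathcomp Require Import all_boot all_order all_algebra.
From mathcomp Require Import all_field.
From Stdlib Require Import Classical.
Set Implicit Arguments. Unset Strict Implicit. Unset Printing Implicit Defensive.
Import Order.TTheory GRing.Theory Num.Theory.
Local Open Scope ring_scope.

(** Suppose a trigonometric polynomial [f] has [f g0 <> 0].  All its values lie
    in the subring of [C] generated by the coefficients, the coordinates of the
    points and their inverses.  A nonzero element of a finitely generated
    subring of a field of characteristic zero survives in some finite residue
    field [L] (the Nullstellensatz over [int]).  Modulo that residue map, [f] is
    constant on the cosets of [N Z^r] with [N = #|L| - 1], so ubiquity yields a
    point of [K] at which [f] has the nonzero residue of [f g0]. *)

(* [B -> F] stands for its image, a subring of [F]: the second condition says
   that [phi] factors through that image. *)
Definition finite_field_separated (B : idomainType) (F : fieldType)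
    (iota : {rmorphism B -> F}) : Prop :=
  forall b, iota b != 0 ->
  exists (L : finFieldType) (phi : {rmorphism B -> L}),
    (forall u, iota u = 0 -> phi u = 0) /\ phi b != 0.

(** * Polynomials over [B], their images and their roots *)

Definition horner_at (B : idomainType) (F : fieldType)
    (iota : {rmorphism B -> F}) (x : F) : {rmorphism {poly B} -> F} :=
  horner_morph (fun b => mulrC x (iota b)).

Lemma horner_atE (B : idomainType) (F : fieldType)
    (iota : {rmorphism B -> F}) (x : F) (p : {poly B}) :
  horner_at iota x p = (map_poly iota p).[x].
Proof. by []. Qed.

Lemma ex_minimal (T : Type) (P : T -> Prop) (mu : T -> nat) :
  (exists x, P x) -> exists2 x, P x & forall y, P y -> (mu x <= mu y)%N.
Proof.
case=> x; have [n] := ubnP (mu x); elim: n x => // n IHn x le_xn Px.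
case: (classic (exists2 y, P y & (mu y < mu x)%N)) => [[y Py lt_yx]|minx].
  by apply: (IHn y) => //; apply: leq_trans lt_yx _.
exists x => // y Py; rewrite leqNgt; apply/negP => lt_yx.
by apply: minx; exists y.
Qed.

(** As [f] may kill leading coefficients, the terms beyond the degree of the image are dropped. *)
Lemma map_poly_truncate (B F : nzRingType) (f : {rmorphism B -> F})
    (p : {poly B}) :
  exists q : {poly B},
    map_poly f q = map_poly f p /\ size q = size (map_poly f q).
Proof.
pose q := \poly_(i < size (map_poly f p)) p`_i.
have eqf : map_poly f q = map_poly f p.
  apply/polyP => i; rewrite !coef_map coef_poly.
  case: ltnP => // le; rewrite /= -[RHS]coef_map [RHS]nth_default //.
  exact: rmorph0.
exists q; split=> //; apply/eqP; rewrite eqn_leq size_poly andbT eqf.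
exact: size_poly.
Qed.

Lemma finField_ext_root (L : finFieldType) (p : {poly L}) :
  (1 < size p)%N ->
  exists (M : finFieldType) (j : {rmorphism L -> M}) (y : M),
    root (map_poly j p) y.
Proof.
move=> sz_p; have p_neq0 : p != 0 by rewrite -size_poly_gt0 ltnW.
have [M [rs Dp _]] := FinSplittingFieldFor p_neq0.
pose j : {rmorphism L -> FinFieldExtType M} := GRing.in_alg M.
case: rs Dp => [|y rs] Dp.
  have := eqp_size Dp; rewrite big_nil size_poly1 size_map_poly => sz1.
  by rewrite sz1 in sz_p.
exists (FinFieldExtType M), j, y.
suff : root (map_poly (GRing.in_alg M) p) y by [].
by rewrite (eqp_root Dp) big_cons rootM root_XsubC eqxx.
Qed.

(** Characteristic zero makes [iota] injective, so reduction modulo any prime above the absolute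
    value of [b] works. *)
Lemma intr_separated (F : numFieldType) (iota : {rmorphism int -> F}) :
  finite_field_separated iota.
Proof.
move=> b iota_b.
have iota_inj u : iota u = 0 -> u = 0.
  by rewrite -[u]intz rmorph_int => /eqP; rewrite intr_eq0 intz => /eqP.
have b_neq0 : (`|b| != 0)%N.
  by rewrite absz_eq0; apply: contraNneq iota_b => ->; rewrite rmorph0.
have [p lt_bp pr_p] := prime_above `|b|.
exists 'F_p, (intr : {rmorphism int -> 'F_p}); split.
  by move=> u /iota_inj ->; rewrite rmorph0.
have -> : (b%:~R == 0 :> 'F_p) = (`|b|%:R == 0 :> 'F_p).
  case: b {iota_b b_neq0 lt_bp} => n //.
  by rewrite NegzE mulrNz oppr_eq0 abszN.
rewrite -(dvdn_pcharf (pchar_Fp pr_p)); apply/negP => /dvdn_leq.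
by rewrite lt0n leqNgt lt_bp => /(_ b_neq0).
Qed.

(** * Extending residue maps from [B] to the ring generated by [x] *)

Lemma map_poly_pdiv (B : idomainType) (F : fieldType)
    (iota : {rmorphism B -> F}) (p q : {poly B}) :
  size q = size (map_poly iota q) -> q != 0 ->
  let c := lead_coef q ^+ scalp p q in
  [/\ iota (lead_coef q) != 0, c *: p = (p %/ q) * q + p %% q
    & (size (map_poly iota (p %% q)) < size (map_poly iota q))%N].
Proof.
move=> sz_q q_neq0; split; last 2 first.
- exact: Pdiv.Idomain.divp_eq.
- by rewrite -sz_q; apply: leq_ltn_trans (size_poly _ _) _; rewrite ltn_modp.
by rewrite lead_coefE -coef_map sz_q -lead_coefE lead_coef_eq0 -size_poly_gt0
           -sz_q size_poly_gt0.
Qed.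

(* [x] is algebraic over the fraction field [k] of the image of [B], with
   minimal polynomial [m]; the conclusion says that [k[x]] is a field. *)
Lemma horner_at_inv (B : idomainType) (F : fieldType)
    (iota : {rmorphism B -> F}) (x : F) (m : {poly B}) :
  map_poly iota m != 0 -> horner_at iota x m = 0 ->
  (forall u, map_poly iota u != 0 -> horner_at iota x u = 0 ->
     (size (map_poly iota m) <= size (map_poly iota u))%N) ->
  size m = size (map_poly iota m) ->
  forall q, horner_at iota x q != 0 ->
  exists v c, iota c != 0 /\ horner_at iota x (q * v) = iota c.
Proof.
set ev := horner_at iota x => m_neq0 mx0 min_m sz_m.
have evC c : ev c%:P = iota c by rewrite /ev horner_atE map_polyC hornerC.
have m0 : m != 0 by rewrite -size_poly_gt0 sz_m size_poly_gt0.
move=> q; have [n] := ubnP (size (map_poly iota q)).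
elim: n q => // n IHn q0 le_qn qx_neq0.
have [q [eq_q sz_q]] := map_poly_truncate iota q0.
have evq : ev q = ev q0 by rewrite /ev !horner_atE eq_q.
suff [v [c [c0 qv]]] : exists v c, iota c != 0 /\ ev (q * v) = iota c.
  by exists v, c; split=> //; rewrite rmorphM -evq -rmorphM.
rewrite -eq_q -evq in le_qn qx_neq0 => {q0 eq_q evq}.
have q_neq0 : q != 0 by apply: contraNneq qx_neq0 => ->; rewrite rmorph0.
(* Pseudo-division of [q] by [m] leaves a smaller remainder whose value at [x] is a nonzero scalar
   times that of [q]. *)
case: (leqP (size (map_poly iota m)) (size (map_poly iota q))) => [le_mq|lt_qm].
  have [b0 Dq lt_r] := map_poly_pdiv q sz_m m0.
  set b := lead_coef m ^+ _ in Dq; set r := q %% m in Dq lt_r.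
  have bb0 : iota b != 0 by rewrite rmorphXn expf_neq0.
  have evr : ev r = iota b * ev q.
    have := congr1 ev Dq; rewrite -mul_polyC !(rmorphM, rmorphD) evC mx0.
    by rewrite mulr0 add0r.
  have [||v [c [c0 rv]]] := IHn r.
  - by rewrite (leq_trans lt_r) // (leq_trans le_mq).
  - by rewrite evr mulf_neq0.
  exists (b%:P * v), c; split=> //.
  by rewrite -rv !rmorphM evr evC mulrCA mulrA.
(* With [q] smaller than [m], the roles are swapped: the remainder of [m] by [q] has value a
   multiple of [ev q], so the induction hypothesis for it settles [q]. *)
have [b0 Dm lt_r] := map_poly_pdiv m sz_q q_neq0.
set b := lead_coef q ^+ _ in Dm; set r := m %% q in Dm lt_r.
set s := m %/ q in Dm.
have bb0 : iota b != 0 by rewrite rmorphXn expf_neq0.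
have evr : ev r = - (ev s * ev q).
  have := congr1 ev Dm; rewrite -mul_polyC !(rmorphM, rmorphD) mx0 mulr0.
  by move/esym/eqP; rewrite addrC addr_eq0 => /eqP.
have [r0|r_neq0] := eqVneq (ev r) 0; last first.
  have [|v [c [c0 rv]]] := IHn r _ r_neq0; first exact: leq_trans lt_r _.
  exists (- (s * v)), c; split=> //.
  by rewrite -rv mulrN rmorphN !rmorphM evr mulNr [ev s * ev q]mulrC mulrA.
(* If the remainder vanishes at [x], so does the quotient [s]; minimality of [m] then leaves no
   degree for [q], which is constant. *)
have s0 : ev s = 0.
  by move/eqP: evr; rewrite r0 eq_sym oppr_eq0 mulf_eq0 (negPf qx_neq0) orbF
    => /eqP.
have sz_s : size (map_poly iota (s * q)) = size (map_poly iota m).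
  have -> : s * q = b *: m - r by rewrite Dm addrK.
  rewrite rmorphB /= map_polyZ size_polyDl size_scale // size_polyN.
  exact: ltn_trans lt_r lt_qm.
have sq0 : map_poly iota (s * q) != 0.
  by rewrite -size_poly_gt0 sz_s size_poly_gt0.
rewrite rmorphM /= in sz_s sq0; move: sq0; rewrite mulf_eq0 negb_or.
case/andP=> ms0 mq0; have := min_m s ms0 s0.
rewrite -sz_s size_mul // => le_s.
exists 1, (q`_0); have sz1 : size q = 1%N.
  apply/eqP; rewrite eqn_leq size_poly_gt0 q_neq0 andbT sz_q.
  by move: le_s; rewrite -subn1 leq_subLR addnC leq_add2r.
have Dq : q = (q`_0)%:P by apply: size1_polyC; rewrite sz1.
by rewrite mulr1 -evC -Dq.
Qed.

(** A residue map of [B] is extended by sending [x] to a root, in a finite extension, of its reduced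
    minimal polynomial, or of [q X - 1] if [x] is transcendental. *)
Lemma horner_at_separated (B : idomainType) (F : fieldType)
    (iota : {rmorphism B -> F}) (x : F) :
  finite_field_separated iota -> finite_field_separated (horner_at iota x).
Proof.
move=> sep q qx_neq0.
have evC c : horner_at iota x c%:P = iota c.
  by rewrite horner_atE map_polyC hornerC.
have map0 (L : finFieldType) (phi : {rmorphism B -> L}) u :
    (forall b, iota b = 0 -> phi b = 0) ->
    map_poly iota u = 0 -> map_poly phi u = 0.
  move=> kphi /polyP u0; apply/polyP => i; rewrite coef_map coef0; apply: kphi.
  by have := u0 i; rewrite coef_map coef0.
case: (classic (exists m, map_poly iota m != 0 /\ horner_at iota x m = 0)) =>
    [/(ex_minimal (fun m => size (map_poly iota m)))|trans].
  case=> m1 [m1_neq0 m1x] min_m1.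
  have [m [eqm sz_m]] := map_poly_truncate iota m1.
  have m_neq0 : map_poly iota m != 0 by rewrite eqm.
  have mx : horner_at iota x m = 0 by rewrite horner_atE eqm.
  have min_m u : map_poly iota u != 0 -> horner_at iota x u = 0 ->
      (size (map_poly iota m) <= size (map_poly iota u))%N.
    by rewrite eqm => u0 ux; apply: min_m1.
  have m0 : m != 0 by rewrite -size_poly_gt0 sz_m size_poly_gt0.
  have [v [c [c0 qv]]] := horner_at_inv m_neq0 mx min_m sz_m qx_neq0.
  have [b0 _ _] := map_poly_pdiv 0 sz_m m0.
  (* The first factor preserves the degree of [m] and makes pseudo-division by [m] cancellable under
     [phi]; the second, being the value of [q * v], keeps [q] nonzero. *)
  have [|L [phi [kphi]]] := sep (lead_coef m * c).
    by rewrite rmorphM mulf_neq0.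
  rewrite rmorphM mulf_eq0 negb_or => /andP[phib phic].
  have sz_phim : (1 < size (map_poly phi m))%N.
    rewrite size_map_poly_id0 // ltnNge; apply/negP => /size1_polyC Dm.
    move: mx b0; rewrite Dm evC lead_coefC => ->.
    by rewrite eqxx.
  have [M [j [y /rootP ym]]] := finField_ext_root sz_phim.
  pose psi := horner_at (j \o phi) y.
  have psim : psi m = 0 by rewrite /psi horner_atE map_poly_comp.
  have psiC d : psi d%:P = j (phi d).
    by rewrite /psi horner_atE map_polyC hornerC.
  (* The remainder of [u] by [m] vanishes at [x], hence has zero image by minimality. *)
  have kpsi u : horner_at iota x u = 0 -> psi u = 0.
    move=> ux; have [_ Du lt_r] := map_poly_pdiv u sz_m m0.
    set b := lead_coef m ^+ _ in Du; set r := u %% m in Du lt_r.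
    have rx : horner_at iota x r = 0.
      have := congr1 (horner_at iota x) Du; rewrite -mul_polyC.
      by rewrite !(rmorphM, rmorphD) mx ux !mulr0 add0r.
    have r0 : map_poly iota r = 0.
      apply/eqP; apply: contraTT lt_r => r0; rewrite -leqNgt; exact: min_m.
    have psir : psi r = 0.
      by rewrite /psi horner_atE map_poly_comp (map0 _ phi) // rmorph0 horner0.
    have := congr1 psi Du; rewrite -mul_polyC !(rmorphM, rmorphD) psim psir.
    rewrite mulr0 addr0 psiC => /eqP; rewrite mulf_eq0 fmorph_eq0 rmorphXn.
    by rewrite expf_eq0 (negPf phib) andbF => /eqP.
  exists M, psi; split=> //.
  have : psi (q * v - c%:P) = 0 by apply: kpsi; rewrite rmorphB evC qv subrr.
  move/eqP; rewrite rmorphB rmorphM psiC subr_eq0 => /eqP qvc.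
  apply/eqP => q0; move: qvc; rewrite q0 mul0r => /esym/eqP.
  by rewrite fmorph_eq0 (negPf phic).
(* Transcendental case: only polynomials with zero image vanish at [x], so any target [y] is
   consistent. *)
have [q1 [eqq sz_q]] := map_poly_truncate iota q.
have q1_neq0 : q1 != 0.
  rewrite -size_poly_gt0 sz_q size_poly_gt0 eqq.
  by apply: contraNneq qx_neq0; rewrite horner_atE => ->; rewrite horner0.
have [b0 _ _] := map_poly_pdiv 0 sz_q q1_neq0.
have [L [phi [kphi phib]]] := sep _ b0.
have eqphi : map_poly phi q1 = map_poly phi q.
  apply/eqP; rewrite -subr_eq0 -rmorphB; apply/eqP; apply: map0 => //.
  by rewrite rmorphB /= eqq subrr.
have q_neq0 : map_poly phi q != 0.
  by rewrite -eqphi -size_poly_gt0 size_map_poly_id0 // size_poly_gt0.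
(* A root of [q X - 1] is not a root of [q]. *)
pose p := map_poly phi q * 'X - 1.
have sz_p : (1 < size p)%N.
  by rewrite /p size_polyDl size_mulX // ?size_polyN ?size_poly1 ltnS
             size_poly_gt0.
have [M [j [y]]] := finField_ext_root sz_p.
rewrite /root rmorphB rmorphM /= rmorph1 map_polyX !hornerE subr_eq0 => /eqP qy.
exists M, (horner_at (j \o phi) y); split=> [u ux|].
  rewrite horner_atE map_poly_comp (map0 _ phi) ?rmorph0 ?horner0 //.
  by apply/eqP/negPn/negP => u0; apply: trans; exists u.
rewrite horner_atE map_poly_comp; apply/eqP => q0.
by move/eqP: qy; rewrite q0 mul0r eq_sym oner_eq0.
Qed.

(** [B] is an iterated polynomial ring over [int], one variable per entry of [s]. *)
Lemma ex_separated_subring (F : numFieldType) (s : seq F) :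
  exists (B : idomainType) (iota : {rmorphism B -> F}),
    finite_field_separated iota /\ (forall x, x \in s -> exists b, iota b = x).
Proof.
elim: s => [|x s [B [iota [sep lift]]]].
  exists int, (intr : {rmorphism int -> F}); split=> //.
  exact: intr_separated.
exists {poly B}, (horner_at iota x); split; first exact: horner_at_separated.
move=> y; rewrite inE => /predU1P[->|/lift [b <-]].
  by exists 'X; rewrite horner_atE map_polyX hornerX.
by exists b%:P; rewrite horner_atE map_polyC hornerC.
Qed.

(** * Periodicity modulo [N] and conclusion *)

Lemma multiples_finite_index (r N : nat) : (0 < N)%N ->
  finite_index (fun h : 'rV[int]_r => forall k, (N %| h ord0 k)%Z).
Proof.
case: N => // N _.
pose res (t : {ffun 'I_r -> 'I_N.+1}) : 'rV[int]_r := \row_k (t k : nat)%:Z.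
exists (map res (enum {ffun 'I_r -> 'I_N.+1})) => g.
exists (res [ffun k => inord `|(g ord0 k %% N.+1%:Z)%Z|]).
  by rewrite map_f // mem_enum.
move=> k; rewrite !mxE ffunE inordK.
  rewrite gez0_abs ?modz_ge0 // {1}(divz_eq (g ord0 k) N.+1%:Z) addrK.
  exact: dvdz_mull.
by rewrite -ltz_nat gez0_abs ?modz_ge0 // ltz_mod.
Qed.

(** The unit group of [L] has order [#|L| - 1]. *)
Lemma finField_exprz_eq (L : finFieldType) (u : L) (a b : int) :
  u != 0 -> (#|L|.-1 %| a - b)%Z -> u ^ a = u ^ b.
Proof.
move=> u0 /dvdzP[q Dq]; rewrite -[a](subrK b) Dq expfzDr //.
have uN : u ^ (#|L|.-1 : int) = 1.
  rewrite -exprnP; apply: (mulfI u0); rewrite -exprS prednK ?expf_card ?mulr1 //.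
  exact: ltnW (card_finNzRing_gt1 L).
by rewrite [q * _]mulrC -exprz_exp uN exp1rz mul1r.
Qed.

Theorem theorem3p5 (C : numClosedFieldType) (r : nat) (K : 'rV[int]_r -> Prop) :
  ubiquitous K -> strictly_pos_def C K.
Proof.
move=> ubK f [n [c [x [tx Df]]]] fK g0; apply/eqP/negPn/negP => fg0.
have x0 i k : x i k != 0 by rewrite -normr_eq0 tx oner_eq0.
pose s := [seq c i | i <- enum 'I_n] ++
  ([seq x i.1 i.2 | i <- enum {: 'I_n * 'I_r}] ++
   [seq (x i.1 i.2)^-1 | i <- enum {: 'I_n * 'I_r}]).
have [B [iota [sep lift]]] := ex_separated_subring s.
have /fin_all_exists[c' Dc] i : exists b, iota b = c i.
  by apply: lift; rewrite mem_cat map_f ?mem_enum.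
have /fin_all_exists[X DX] (i : 'I_n * 'I_r) : exists b, iota b = x i.1 i.2.
  by apply: lift;
    rewrite !mem_cat (map_f (fun i => x i.1 i.2)) ?mem_enum ?orbT.
have /fin_all_exists[Y DY] (i : 'I_n * 'I_r) : exists b, iota b = (x i.1 i.2)^-1.
  by apply: lift;
    rewrite !mem_cat (map_f (fun i => (x i.1 i.2)^-1)) ?mem_enum ?orbT.
(* Negative powers are lifted through [Y], as [X i] need not be invertible in [B]; [Negz a] is
   [-(a+1)]. *)
pose pw (i : 'I_n * 'I_r) (z : int) : B :=
  match z with Posz a => X i ^+ a | Negz a => Y i ^+ a.+1 end.
pose f' (g : 'rV[int]_r) := \sum_(i < n) c' i * \prod_(k < r) pw (i, k) (g ord0 k).
have Df' g : iota (f' g) = f g.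
  rewrite Df rmorph_sum; apply: eq_bigr => i _.
  rewrite rmorphM Dc rmorph_prod; congr (_ * _); apply: eq_bigr => k _.
  by rewrite /pw; case: (g ord0 k) => a; rewrite rmorphXn /= ?DX ?DY // exprVn.
rewrite -Df' in fg0; have [L [phi [kphi phif]]] := sep _ fg0.
(* [X i * Y i - 1] lies in the kernel of [iota], which [phi] kills. *)
have phiXY i : phi (X i) * phi (Y i) = 1.
  apply/eqP; rewrite -subr_eq0 -rmorphM -(rmorph1 phi) -rmorphB; apply/eqP.
  by apply: kphi; rewrite rmorphB rmorphM rmorph1 DX DY divff ?subrr.
have phiX i : phi (X i) != 0.
  by apply/eqP => X0; move/eqP: (phiXY i); rewrite X0 mul0r eq_sym oner_eq0.
have phiY i : phi (Y i) = (phi (X i))^-1.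
  by apply: (mulfI (phiX i)); rewrite phiXY divff.
have phif' g : phi (f' g) =
    \sum_(i < n) phi (c' i) * \prod_(k < r) phi (X (i, k)) ^ g ord0 k.
  rewrite rmorph_sum; apply: eq_bigr => i _.
  rewrite rmorphM rmorph_prod; congr (_ * _); apply: eq_bigr => k _.
  by rewrite /pw; case: (g ord0 k) => a; rewrite rmorphXn //= phiY exprVn.
have N_gt0 : (0 < #|L|.-1)%N.
  by rewrite -subn1 subn_gt0 card_finNzRing_gt1.
have [|k [Kk Hk]] := ubK _ _ (multiples_finite_index r N_gt0) g0.
  split=> [k|a b Ha Hb k]; first by rewrite mxE dvdz0.
  by rewrite !mxE rpredB.
(* [f] vanishes at [k], and [k] and [g0] agree modulo [N], so the residue of [f g0] would be
   zero. *)
move/eqP: phif; apply; rewrite -(kphi (f' k)) ?Df' ?fK // !phif'.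
apply: eq_bigr => i _; congr (_ * _); apply: eq_bigr => j _; apply/esym.
by apply: finField_exprz_eq => //; have := Hk j; rewrite !mxE.
Qed.
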